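(* Let $G$ be a (possibly infinite) group and let $G=C_1\cup\ldots\cup C_n$ be an irredundant cover of $G$ by left cosets $C_i=g_iH_i$ of subgroups $H_i\le G$, with $g_i\in G$. Then $|G:H_i|\le 2^{n-1}$ for $i=1,\ldots,n$ (in particular every $H_i$ has finite index in $G$). This bound is best possible for every $n$: for every integer $n\ge 1$ there exist a group $G$ and an irredundant cover of $G$ by $n$ left cosets $g_1H_1,\ldots,g_nH_n$ of subgroups of $G$ such that $|G:H_i|=2^{n-1}$ for some $i\in\{1,\ldots,n\}$.
   Context: A cover $G=C_1\cup\ldots\cup C_n$ of a group $G$ by cosets is called irredundant if no $C_i$ can be omitted, i.e. $\bigcup_{j\neq i}C_j\neq G$ for every $i\in\{1,\ldots,n\}$. $|G:H|$ denotes the index of the subgroup $H$ in $G$. *)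

(* Defs.v *)
From mathcomp Require Export all_boot.
From mathcomp Require Export boolp classical_sets functions cardinality.

Set Implicit Arguments.
Unset Strict Implicit.
Unset Printing Implicit Defensive.

Local Open Scope classical_set_scope.
Local Open Scope group_scope.

(* [group_closed] asks for 1 and closure under (x, y) |-> x * y^-1.  Subgroups
   are arbitrary, not necessarily decidable, sets. *)
Definition subgroup (G : groupType) (H : set G) : Prop := group_closed [in H].

Definition left_coset (G : groupType) (g : G) (H : set G) : set G :=
  [set g * h | h in H].

(* The index |G : H| is the cardinal of this set of sets; it is compared with
   natural numbers by means of [#=] and [#<=], so it may be infinite. *)
Definition left_cosets (G : groupType) (H : set G) : set (set G) :=
  [set left_coset g H | g in [set: G]].

Definition irredundant_cover (T : Type) (n : nat) (C : 'I_n -> set T) : Prop :=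
  \bigcup_i C i = [set: T] /\
  forall i, \bigcup_(j in [set j | j != i]) C j <> [set: T].

(* Main.v *)
Require Import Defs.
From mathcomp Require Import all_fingroup all_algebra.

(** Pick [x] in [C_i] outside the other [C_j], and let [y_1, ..., y_N] represent
    distinct left cosets of [H_i].  For [a <> b] the element [x y_a^-1 y_b] is
    not in [C_i = x H_i], hence lies in some [C_j = g_j H_j] with [j <> i], i.e.
    [y_b H_j = y_a x^-1 g_j H_j]; for [a = b] no [C_j] contains it.  Labelling
    cosets by numbers, each condition reads [u_j a = v_j b], so the matrix with
    entries [\prod_(j != i) (u_j a - v_j b)] is diagonal and invertible.  Being
    an entrywise product of [n - 1] matrices of rank at most 2, it has rank at
    most [2 ^ (n - 1)], whence [N <= 2 ^ (n - 1)].

    For sharpness, take [(Z/2)^(n-1)], covered by [{0}] and the [n - 1] affine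
    hyperplanes [v_j = 1]. *)

Local Open Scope classical_set_scope.
Local Open Scope card_scope.

Section RankBound.
Local Open Scope ring_scope.
Import GRing.Theory.

(** Expanding the product gives one term per set of indices [j] contributing [u j a], the others
    contributing [- v j b]. Each term splits into a function of [a] times one of [b], so the matrix
    factors through a space of dimension [2 ^ m]. *)
Lemma rank_prod_sub (F : fieldType) (m N : nat) (u v : 'I_m -> 'I_N -> F) :
  (\rank (\matrix_(a, b) \prod_j (u j a - v j b))%R <= 2 ^ m)%N.
Proof.
pose P := \matrix_(a < N, k < #|{set 'I_m}|)
  \prod_(j in (enum_val k : {set 'I_m})) u j a.
pose Q := \matrix_(k < #|{set 'I_m}|, b < N)
  \prod_(j in ~: (enum_val k : {set 'I_m})) - v j b.
suff -> : \matrix_(a, b) \prod_j (u j a - v j b) = P *m Q.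
  apply: leq_trans (mxrankM_maxl _ _) _; apply: leq_trans (rank_leq_col _) _.
  by rewrite -cardsT -powersetT card_powerset cardsT card_ord.
apply/matrixP => a b; rewrite !mxE bigA_distr big_enum_val /=.
apply: eq_bigr => k _; rewrite !mxE (bigID (mem (enum_val k : {set 'I_m}))) /=.
by congr (_ * _); apply: eq_big => j; rewrite ?inE // => /negPf; case: ifP.
Qed.

Lemma skew_labels_bound (T : eqType) (m N : nat) (p q : 'I_m -> 'I_N -> T) :
  (forall j a, p j a != q j a) ->
  (forall a b, a != b -> exists j, p j a = q j b) ->
  (N <= 2 ^ m)%N.
Proof.
move=> pq_diag pq_off.
(* Labels outside [codom (q j)] all get the same number, but it differs from that of every [q j b],
   and only such comparisons occur. Characteristic 0 keeps distinct indices distinct. *)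
pose phi j (c : T) : rat := (index c (codom (q j)))%:R.
have phi_eq j a b : phi j (p j a) = phi j (q j b) -> p j a = q j b.
  move/eqP; rewrite Num.Theory.eqr_nat => /eqP e.
  have qb : q j b \in codom (q j) by exact: codom_f.
  have pa : p j a \in codom (q j) by rewrite -index_mem e index_mem.
  by rewrite -(nth_index (q j b) pa) e nth_index.
have := @rank_prod_sub _ m N (fun j a => phi j (p j a)) (fun j b => phi j (q j b)).
rewrite mxrank_unit // unitmxE.
set A := \matrix_(_, _) _.
have -> : A = diag_mx (\row_a A a a).
  apply/matrixP => a b; rewrite [RHS]mxE mxE.
  have [<-|ab] := eqVneq a b; first by rewrite !mxE.
  by have [j e] := pq_off _ _ ab; rewrite (bigD1 j) //= e subrr mul0r.
rewrite det_diag unitfE; apply/prodf_neq0 => a _; rewrite !mxE.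
apply/prodf_neq0 => j _; rewrite subr_eq0; apply/eqP => /phi_eq.
exact/eqP.
Qed.

End RankBound.

Section Cosets.
Local Open Scope group_scope.
Variable G : groupType.

Lemma mem_left_coset (g x : G) (H : set G) :
  left_coset g H x <-> H (g^-1 * x).
Proof.
split=> [[h Hh <-]|Hx]; first by rewrite mulKg.
by exists (g^-1 * x) => //; rewrite mulVKg.
Qed.

Lemma left_coset_eqP (H : set G) (x y : G) : subgroup H ->
  left_coset x H = left_coset y H <-> H (x^-1 * y).
Proof.
move=> sH; have [/set_mem H1 _] := sH.
have HM a b : H a -> H b -> H (a * b).
  by move=> /mem_set Ha /mem_set Hb; apply/set_mem/(group_closedM sH).
have HV a : H a -> H a^-1.
  by move=> /mem_set Ha; apply/set_mem/(group_closedV sH).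
split=> [e|Hxy].
  by apply/mem_left_coset; rewrite e; apply/mem_left_coset; rewrite mulVg.
apply/seteqP; split=> z /mem_left_coset Hz; apply/mem_left_coset.
  rewrite -(mulKVg x z) mulgA; apply: HM => //.
  by rewrite -[_ * x]invgK invgM invgK; apply: HV.
by rewrite -(mulKVg y z) mulgA; apply: HM.
Qed.

(** The index is not yet known to be finite, so the bound is on any finite family of distinct
    cosets. *)
Lemma irredundant_cover_index_bound (n N : nat) (g : 'I_n -> G)
    (H : 'I_n -> set G) (i : 'I_n) (y : 'I_N -> G) :
  (forall j, subgroup (H j)) ->
  irredundant_cover (fun j => left_coset (g j) (H j)) ->
  (forall a b, left_coset (y a) (H i) = left_coset (y b) (H i) -> a = b) ->
  (N <= 2 ^ (n - 1))%N.
Proof.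
move=> sH [cov irr] y_inj.
have [x xNC] : exists x, forall j, j != i -> ~ left_coset (g j) (H j) x.
  apply: contrapT => /forallNP nx; apply: (irr i).
  apply/seteqP; split=> // x _; have /existsNP[j /not_implyP[ji /contrapT xj]] := nx x.
  by exists j.
have xC z : exists j, left_coset (g j) (H j) z.
  by have : [set: G] z by []; rewrite -cov => -[j _ ?]; exists j.
have xi : left_coset (g i) (H i) = left_coset x (H i).
  have [j xj] := xC x; have [ji|/xNC//] := eqVneq j i; subst j.
  by apply/left_coset_eqP => //; apply/mem_left_coset.
have labels j a b : left_coset (y a * x^-1 * g j) (H j) = left_coset (y b) (H j)
    <-> left_coset (g j) (H j) (x * (y a)^-1 * y b).
  by rewrite left_coset_eqP // mem_left_coset !invgM invgK !mulgA.
(* The labels are the cosets themselves; [lift i] enumerates the [n.-1] indices other than [i]. *)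
rewrite subn1; apply: (@skew_labels_bound (set G) n.-1 N
  (fun k a => left_coset (y a * x^-1 * g (lift i k)) (H (lift i k)))
  (fun k b => left_coset (y b) (H (lift i k)))).
- move=> k a; apply/eqP => /labels; rewrite mulgVK.
  by apply: xNC; rewrite eq_sym neq_lift.
- move=> a b ab; have [j zj] := xC (x * (y a)^-1 * y b).
  have [ji|] := eqVneq j i; last first.
    by rewrite eq_sym => /unlift_some[k jk _]; exists k; rewrite -jk; apply/labels.
  (* Membership in [x H_i] would put [y a] and [y b] in the same coset of [H_i]. *)
  move: zj; rewrite ji xi mem_left_coset -mulgA mulKg => /left_coset_eqP.
  by move=> /(_ (sH i)) /y_inj /eqP; rewrite (negPf ab).
Qed.

End Cosets.

(** An infinite set would contain a copy of [I_K.+1]. *)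
Lemma card_le_of_finite_bound (T : Type) (A : set T) (K : nat) :
  (forall N, `I_N #<= A -> (N <= K)%N) -> finite_set A /\ A #<= `I_K.
Proof.
move=> leK; have finA : finite_set A.
  apply: contrapT => /infiniteP leA.
  have /leK : `I_K.+1 #<= A by apply: card_le_trans leA; exact: subset_card_le.
  by rewrite ltnn.
split=> //; have [N AN] := (finite_setP A).1 finA.
by rewrite (card_le_eql AN) card_le_II leK // (card_le_eqr AN).
Qed.

Lemma card_le_left_cosets (G : groupType) (H : set G) (N : nat) :
  `I_N #<= left_cosets H ->
  exists y : 'I_N -> G, forall a b, left_coset (y a) H = left_coset (y b) H -> a = b.
Proof.
move=> /pcard_leP[f].
have /choice[y yE] (a : 'I_N) : exists x, left_coset x H = f a.
  by have [x _ xE] := 'funS_f (ltn_ord a); exists x.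
exists y => a b; rewrite !yE => fab; apply/val_inj.
by apply: ('inj_f) fab; apply/mem_set => /=; exact: ltn_ord.
Qed.

Section Sharpness.
Local Open Scope ring_scope.
Import GRing.Theory.
Variable m : nat.

Definition cube_subgroup (i : 'I_m.+1) : set 'rV['F_2]_m :=
  if unlift ord0 i is Some j then [set v | v 0 j = 0] else [set 0].

Definition cube_translate (i : 'I_m.+1) : 'rV['F_2]_m :=
  if unlift ord0 i is Some j then delta_mx 0 j else 0.

(** Over ['F_2] a nonzero coordinate equals 1; in this form, covering just says that a nonzero
    vector has a nonzero coordinate. *)
Definition cube_coset (i : 'I_m.+1) : set 'rV['F_2]_m :=
  if unlift ord0 i is Some j then [set v | v 0 j != 0] else [set 0].

Lemma cube_subgroupP i : subgroup (cube_subgroup i).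
Proof.
rewrite /cube_subgroup; case: (unlift ord0 i) => [j|]; split.
- by apply/mem_set; rewrite /= mxE.
- move=> u v /set_mem /= u0 /set_mem /= v0; apply/mem_set => /=.
  by rewrite mxE u0 mxE v0 subrr.
- exact/mem_set.
- by move=> u v /set_mem /= -> /set_mem /= ->; apply/mem_set/subrr.
Qed.

Lemma cube_cosetE i :
  left_coset (cube_translate i) (cube_subgroup i) = cube_coset i.
Proof.
have F2 (x : 'F_2) : x != 0 -> x = 1.
  by case: x => -[|[|//]] // ? _; apply/val_inj.
apply/seteqP; rewrite /cube_translate /cube_subgroup /cube_coset.
case: (unlift ord0 i) => [j|]; split=> v.
- by move/mem_left_coset => /=; rewrite !mxE !eqxx /= addrC => /subr0_eq ->.
- move=> /= /F2 vj; apply/mem_left_coset => /=.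
  by rewrite !mxE !eqxx vj addNr.
- by move/mem_left_coset => /=; rewrite [(_ * v)%g]addrC => /subr0_eq ->.
- by move=> /= ->; apply/mem_left_coset; apply: addNr.
Qed.

Lemma cube_cover : irredundant_cover cube_coset.
Proof.
split=> [|i].
  apply/seteqP; split=> // v _; have [->|/rV0Pn[j vj]] := eqVneq v 0.
    by exists ord0; rewrite // /cube_coset unlift_none.
  by exists (lift ord0 j); rewrite // /cube_coset liftK.
suff [v vN] : exists v, forall j, j != i -> ~ cube_coset j v.
  by move=> cov; have : [set: 'rV['F_2]_m] v by []; rewrite -cov => -[j /vN].
(* The [k]-th basis vector lies only in the hyperplane of [k], and 0 only in [[set 0]]. *)
rewrite /cube_coset; case: (unliftP ord0 i) => [k ->|->].
  exists (delta_mx 0 k) => j; case: (unliftP ord0 j) => [l ->|->] /=.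
    by rewrite (inj_eq lift_inj) mxE eqxx => /negPf ->.
  by move=> _ /matrixP/(_ 0 k); rewrite !mxE !eqxx => /eqP; rewrite oner_eq0.
exists 0 => j; case: (unliftP ord0 j) => [l ->|->]; last by rewrite eqxx.
by rewrite /= mxE eqxx.
Qed.

(** The subgroup at [ord0] is trivial, so its cosets are the singletons, one per vector. *)
Lemma cube_index : left_cosets (cube_subgroup ord0) #= `I_(2 ^ m).
Proof.
have -> : cube_subgroup ord0 = [set 0] by rewrite /cube_subgroup unlift_none.
have -> : left_cosets [set 0 : 'rV['F_2]_m] = range (fun v => [set v]).
  apply/seteqP; split=> _ [v _ <-]; exists v => //; rewrite /left_coset image_set1;
  by rewrite [(_ * _)%g]addr0.
have -> : (2 ^ m = #|'rV['F_2]_m|)%N by rewrite card_mx card_Fp // mul1n.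
apply: card_eq_trans (inj_card_eq _) _; first by move=> u v _ _ /seteqP[/(_ u erefl)].
rewrite (card_eqr card_II);
exact: pcard_eq (bijection_of_bijective (@enum_rank_bij 'rV['F_2]_m)).
Qed.

End Sharpness.

Theorem theorem3 :
  (forall (G : groupType) (n : nat) (g : 'I_n -> G) (H : 'I_n -> set G),
     (forall i, subgroup (H i)) ->
     irredundant_cover (fun i => left_coset (g i) (H i)) ->
     forall i, finite_set (left_cosets (H i)) /\
               left_cosets (H i) #<= `I_(2 ^ (n - 1))) /\
  (forall n : nat, (1 <= n)%N ->
     exists (G : groupType) (g : 'I_n -> G) (H : 'I_n -> set G),
       [/\ forall i, subgroup (H i),
           irredundant_cover (fun i => left_coset (g i) (H i))
         & exists i, left_cosets (H i) #= `I_(2 ^ (n - 1))]).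
Proof.
split=> [G n g H sH cov i|[//|m] _].
  apply: card_le_of_finite_bound => N /card_le_left_cosets[y y_inj].
  exact: irredundant_cover_index_bound sH cov y_inj.
exists 'rV['F_2]_m, (@cube_translate m), (@cube_subgroup m).
split; first exact: cube_subgroupP.
  rewrite (_ : (fun i => _) = @cube_coset m); first exact: cube_cover.
  by apply/funext => i; exact: cube_cosetE.
by exists ord0; rewrite subn1; exact: cube_index.
Qed.
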